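(* Let $n\in\mathbb{P}$, $n\ge 3$, and $i\in[0,n-1]$. Then \[\sum_{\sigma\in D_n^{\{i\}}}(-1)^{\ell(\sigma)}x^{L(\sigma)}=(1-x^2)\prod_{j=4}^{n}\left(1+(-1)^{j-1}x^{\lfloor j/2\rfloor}\right)^2.\]
   Context: $\mathbb{P}=\{1,2,\dots\}$, $[m,n]=\{m,\dots,n\}$, $[n]=[1,n]$. $B_n$ is the group of bijections $\sigma$ of $[-n,n]$ with $\sigma(-j)=-\sigma(j)$, written in window notation $[\sigma(1),\dots,\sigma(n)]$; $D_n$ is the subgroup of those with an even number of negative entries among $\sigma(1),\dots,\sigma(n)$. For $\sigma\in D_n$: $\ell(\sigma)=\mathrm{inv}(\sigma)+\mathrm{nsp}(\sigma)$, where $\mathrm{inv}(\sigma)=|\{(i,j)\in[n]^2:i<j,\sigma(i)>\sigma(j)\}|$ and $\mathrm{nsp}(\sigma)=|\{(i,j)\in[n]^2:i<j,\sigma(i)+\sigma(j)<0\}|$; $L(\sigma)=\mathrm{oinv}(\sigma)+\mathrm{onsp}(\sigma)$, where $\mathrm{oinv}(\sigma)=|\{(i,j)\in[n]^2:i<j,\sigma(i)>\sigma(j),i\not\equiv j\pmod 2\}|$ and $\mathrm{onsp}(\sigma)=|\{(i,j)\in[n]^2:\sigma(i)+\sigma(j)<0,i\not\equiv j\pmod 2\}|$. For $J\subseteq[0,n-1]$, $D_n^J=\{\sigma\in D_n:\sigma(j)<\sigma(j+1)\ \forall j\in J\}$ with the convention $\sigma(0):=-\sigma(2)$.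
   Formalization: In the definition of onsp the pairs (i,j) are restricted to i<j, as in inv, nsp and oinv; with all ordered pairs, as literally written, the identity fails (for n=3, i=1 the sum is 1−x^4 instead of 1−x^2). *)

(* Defs.v *)
From HB Require Import structures.
From mathcomp Require Import all_boot all_order all_algebra all_fingroup.

Set Implicit Arguments.
Unset Strict Implicit.
Unset Printing Implicit Defensive.

Import Order.TTheory GRing.Theory Num.Theory.

Local Open Scope ring_scope.

(* The interval [-n, n] of integers is encoded by 'I_(n.*2.+1), the ordinal k *)
(* standing for k - n; negation is then rev_ord (lemma centeredN).            *)
Definition centered (n : nat) (k : 'I_(n.*2.+1)) : int := k%:Z - n%:Z.

Lemma centeredN (n : nat) (k : 'I_(n.*2.+1)) :
  centered (rev_ord k) = - centered k.
Proof.
have : (k <= n.*2)%N by rewrite -ltnS.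
rewrite /centered /= subSS; move: (nat_of_ord k) => m lem.
by rewrite -subzn // -addnn PoszD opprB addrAC addrK.
Qed.

Definition Bgroup (n : nat) : {set {perm 'I_(n.*2.+1)}} :=
  [set s : {perm 'I_(n.*2.+1)} | [forall k, s (rev_ord k) == rev_ord (s k)]].

(* The integer s(j), for j in [0, n]. *)
Definition sval_at (n : nat) (s : {perm 'I_(n.*2.+1)}) (j : nat) : int :=
  centered (s (inord (n + j))).

Lemma centered_inord (n j : nat) :
  (j <= n)%N -> centered (inord (n + j) : 'I_(n.*2.+1)) = j%:Z.
Proof.
move=> lejn; rewrite /centered inordK; last first.
  by rewrite ltnS -addnn leq_add2l.
by rewrite PoszD addrAC subrr add0r.
Qed.

(* From here on an ordinal i : 'I_n used as a position stands for i.+1, so    *)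
(* that 'I_n enumerates [n] = {1, ..., n}.                                    *)
Definition window (n : nat) (s : {perm 'I_(n.*2.+1)}) (i : 'I_n) : int :=
  sval_at s i.+1.

Definition Dgroup (n : nat) : {set {perm 'I_(n.*2.+1)}} :=
  [set s in Bgroup n | ~~ odd #|[set i : 'I_n | window s i < 0]|].

Definition inv (n : nat) (s : {perm 'I_(n.*2.+1)}) : nat :=
  #|[set p : 'I_n * 'I_n |
      (p.1 < p.2)%N && (window s p.1 > window s p.2)]|.

Definition nsp (n : nat) (s : {perm 'I_(n.*2.+1)}) : nat :=
  #|[set p : 'I_n * 'I_n |
      (p.1 < p.2)%N && (window s p.1 + window s p.2 < 0)]|.

Definition ell (n : nat) (s : {perm 'I_(n.*2.+1)}) : nat :=
  (inv s + nsp s)%N.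

Definition oinv (n : nat) (s : {perm 'I_(n.*2.+1)}) : nat :=
  #|[set p : 'I_n * 'I_n |
      [&& (p.1 < p.2)%N, window s p.1 > window s p.2
        & (p.1.+1 != p.2.+1 %[mod 2])%N]]|.

(* As for nsp, each pair of positions is counted once (p.1 < p.2): the        *)
(* condition is symmetric, and counting ordered pairs would double onsp.      *)
Definition onsp (n : nat) (s : {perm 'I_(n.*2.+1)}) : nat :=
  #|[set p : 'I_n * 'I_n |
      [&& (p.1 < p.2)%N, window s p.1 + window s p.2 < 0
        & (p.1.+1 != p.2.+1 %[mod 2])%N]]|.

Definition oddlen (n : nat) (s : {perm 'I_(n.*2.+1)}) : nat :=
  (oinv s + onsp s)%N.

(* s(j) for j in [0, n] with the type D convention s(0) := - s(2), which      *)
(* overrides the value 0 that s takes at 0 as a bijection of [-n, n].         *)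
Definition sval_D (n : nat) (s : {perm 'I_(n.*2.+1)}) (j : nat) : int :=
  if j == 0%N then - sval_at s 2 else sval_at s j.

(* Here J ranges over subsets of [0, n - 1]: j : 'I_n stands for j itself. *)
Definition Dquotient (n : nat) (J : {set 'I_n}) : {set {perm 'I_(n.*2.+1)}} :=
  [set s in Dgroup n | [forall j in J, sval_D s j < sval_D s j.+1]].

(* Main.v *)
Require Import Defs.
From HB Require Import structures.
From mathcomp Require Import all_boot all_order all_algebra all_fingroup.
From mathcomp Require Import zify ring.

Set Implicit Arguments.
Unset Strict Implicit.
Unset Printing Implicit Defensive.

Import Order.TTheory GRing.Theory Num.Theory.

Local Open Scope ring_scope.

(* Signed permutations are read as words whose letters are coloured by the    *)
(* parity of their position; L counts the inversions and negative sums of     *)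
(* pairs of letters of different colours.                                     *)
(*   Flipping the sign of the letter +-1 changes neither ell nor L nor the    *)
(* ascent conditions, so the sum over D_n is half of the sum over B_n.        *)
(* Negating the first letter exchanges inversions and negative sums of the    *)
(* pairs containing it, and reduces the case i = 0 to i = 1.                  *)
(*   Exchanging the letters at positions p and p + 2 pairs off the words so   *)
(* that each pair contributes (1 - x^2) times as much to the full sum as to   *)
(* the sum over words with an ascent at p (or at p + 1). So the ascent sum    *)
(* times 1 - x^2 is the full sum over B_n.                                    *)
(*   The full sum vanishes for any colouring with two equal neighbours, by    *)
(* exchanging these two letters. Removing the letter of largest absolute      *)
(* value from an alternating colouring creates such neighbours unless the     *)
(* letter stands at one of the ends, which yields a recursion with the factor *)
(* 1 + x^(2m) + 2 (-1)^(n-1) x^m = (1 + (-1)^(n-1) x^m)^2, m = floor(n/2).    *)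

(** Let S be the sum over $D_n^{\{i\}}$. The lemmas [sum_even_negatives], [sum_D_ascent0] and
    [sum_ascent] together show that 2 (1 - x^2) S is the full sum over B_n, whatever i is. By
    [word_sum_alternating] that full sum is twice the product of (1 + (-1)^(j-1) x^(floor(j/2)))^2
    over 2 <= j <= n. The factors for j = 2 and j = 3 are (1 - x)^2 and (1 + x)^2, with product (1 -
    x^2)^2: one copy of 1 - x^2 cancels and the other stays in front. The recursion behind the
    product rests on [weight_insert_max] and [word_sum_eq_adjacent]; [weight_word] and [sum_Bgroup]
    carry sums over the group to sums over words. *)

Lemma doublep_inj (x y : {poly int}) : 2%:R * x = 2%:R * y -> x = y.
Proof. by apply: mulfI; rewrite -polyC_natr polyC_eq0. Qed.

(** * Weights of coloured words *)

Definition pair_factor (d t : bool) : {poly int} :=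
  if t then (if d then - 'X else -1) else 1.

(* A letter carries its value and the parity of its position; pair_weight a b *)
(* is the contribution of the pair to (-1)^ell X^L when a stands before b.    *)
Definition pair_weight (a b : int * bool) : {poly int} :=
  pair_factor (a.2 (+) b.2) (b.1 < a.1)
  * pair_factor (a.2 (+) b.2) (a.1 + b.1 < 0).

Fixpoint weight (u : seq (int * bool)) : {poly int} :=
  if u is a :: v then (\prod_(b <- v) pair_weight a b) * weight v else 1.

Lemma weight_cat u v :
  weight (u ++ v)
  = weight u * (\prod_(a <- u) \prod_(b <- v) pair_weight a b) * weight v.
Proof.
elim: u => [|a u IH] /=; first by rewrite big_nil !mul1r.
rewrite IH big_cat big_cons /=; ring.
Qed.

(** * Signed permutations as words *)

Definition insert (T : Type) p (x : T) w := take p w ++ x :: drop p w.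

(* The ways to insert the letter n or -n into a word of length n - 1. *)
Definition placements n : seq (nat * int) :=
  [seq (p, x) | p <- iota 0 n, x <- [:: n%:Z; - n%:Z]].

Lemma mem_placements n px :
  (px \in placements n) = (px.1 < n)%N && (absz px.2 == n).
Proof.
case: px => p x; apply/allpairsP/idP => /=.
  by case=> -[q y] /= [hq hy [-> ->]]; move: hq hy; rewrite mem_iota !inE; lia.
by move=> h; exists (p, x); rewrite /= mem_iota !inE; split=> //; lia.
Qed.

Fixpoint signed_words n : seq (seq int) :=
  if n is m.+1 then
    [seq insert px.1 px.2 w | px <- placements n, w <- signed_words m]
  else [:: [::]].

Arguments placements : simpl never.
Arguments signed_words : simpl never.

Lemma signed_wordsS n :
  signed_words n.+1
  = [seq insert px.1 px.2 w | px <- placements n.+1, w <- signed_words n].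
Proof. by []. Qed.

Lemma iotaSr m n : iota m n.+1 = rcons (iota m n) (m + n)%N.
Proof. by rewrite -cats1 -addn1 iotaD. Qed.

Lemma perm_insert (T : eqType) p (x : T) w : perm_eq (insert p x w) (x :: w).
Proof. by rewrite /insert perm_catC /= perm_cons perm_catC cat_take_drop. Qed.

Lemma mem_signed_words n w :
  (w \in signed_words n) = perm_eq (map absz w) (iota 1 n).
Proof.
elim: n w => [|n IH] w.
  rewrite inE /=; apply/eqP/idP => [-> //|/perm_nilP]; by case: w.
apply/idP/idP.
  case/allpairsP=> -[[p x] v] [] /=; rewrite mem_placements IH /=.
  move=> /andP [_ /eqP hx] hv ->.
  rewrite (perm_trans (perm_map absz (perm_insert _ _ _))) //= hx.
  by rewrite [_ :: iota _ _](iotaSr 1 n) perm_sym perm_rcons perm_cons perm_sym.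
move=> hw.
have /mapP [x xw ex] : n.+1 \in map absz w.
  by rewrite (perm_mem hw) mem_iota; lia.
move: hw; case/splitPr: w / xw => w1 w2.
rewrite iotaSr map_cat /= perm_sym perm_rcons -ex perm_sym.
rewrite -cat1s perm_catCA /= perm_cons -map_cat -IH => hw.
rewrite signed_wordsS; apply/allpairsP; exists ((size w1, x), w1 ++ w2); split => //=; last first.
  by rewrite /insert take_size_cat // drop_size_cat.
have sz : size (w1 ++ w2) = n.
  by move: hw; rewrite IH => /perm_size; rewrite size_map size_iota.
by rewrite mem_placements /= -ex eqxx -sz size_cat ltnS leq_addr.
Qed.

Lemma size_signed_word n w : w \in signed_words n -> size w = n.
Proof.
by rewrite mem_signed_words => /perm_size; rewrite size_map size_iota.
Qed.

Lemma absz_signed_word n w x :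
  w \in signed_words n -> x \in w -> (0 < absz x <= n)%N.
Proof.
move=> hw /(map_f absz); move: hw; rewrite mem_signed_words => /perm_mem ->.
by rewrite mem_iota; lia.
Qed.

Lemma uniq_absz_signed_word n w : w \in signed_words n -> uniq (map absz w).
Proof.
by rewrite mem_signed_words => /perm_uniq ->; rewrite iota_uniq.
Qed.

Lemma uniq_signed_words n : uniq (signed_words n).
Proof.
elim: n => [//|n IH]; rewrite signed_wordsS; apply: allpairs_uniq => //.
  apply: allpairs_uniq; [exact: iota_uniq | by [] | by move=> [? ?] [? ?]].
(* The letter of absolute value n + 1 marks the place of insertion, so place, letter and remaining
   word can be read back. *)
have key p x v : (p, x) \in placements n.+1 -> v \in signed_words n ->
  let u := insert p x v in
  let q := find (fun y : int => absz y == n.+1) u in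
  [/\ p = q, x = nth 0 u q & v = take q u ++ drop q.+1 u].
  move=> + hv u q; rewrite mem_placements => /andP [/= hp hx].
  have sv := size_signed_word hv.
  have st : size (take p v) = p by rewrite size_takel // sv -ltnS.
  have -> : q = p.
    rewrite /q /u find_cat ifF /=.
      by rewrite ifT ?addn0 ?st //; lia.
    apply/negbTE/hasPn => y /mem_take /(absz_signed_word hv); lia.
  rewrite /u /insert nth_cat st ltnn subnn; split => //.
  rewrite take_cat st ltnn subnn /= cats0 drop_cat st ltnNge leqnSn /=.
  by rewrite subSn // subnn /= drop0 cat_take_drop.
move=> [[p x] v] [[p' x'] v'] /allpairsP [[[q y] z] [hq hz [-> -> ->]]].
move=> /allpairsP [[[q' y'] z'] [hq' hz' [-> -> ->]]] /= e.
have [e1 e2 e3] := key _ _ _ hq hz.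
have [e1' e2' e3'] := key _ _ _ hq' hz'.
have eq : q = q' by rewrite e1 e1' e.
have ey : y = y' by rewrite e2 e2' e.
have ez : z = z' by rewrite [LHS]e3 [RHS]e3' e.
by rewrite eq ey ez.
Qed.

Lemma signed_words_reindex n (theta : seq int -> seq int)
    (f : seq int -> {poly int}) :
  {in signed_words n, forall w, theta w \in signed_words n} ->
  {in signed_words n, cancel theta theta} ->
  \sum_(w <- signed_words n) f w = \sum_(w <- signed_words n) f (theta w).
Proof.
move=> stab inv; rewrite -(big_map theta predT); apply: perm_big.
apply: uniq_perm; rewrite ?uniq_signed_words //.
  by rewrite map_inj_in_uniq ?uniq_signed_words //; exact: can_in_inj inv.
move=> w; apply/idP/mapP => [hw|[v hv ->]]; last exact: stab.
by exists (theta w); rewrite ?stab ?inv.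
Qed.

(** * Full sums, and their vanishing for equal neighbouring colours *)

Definition word_sum (c : seq bool) :=
  \sum_(w <- signed_words (size c)) weight (zip w c).

Definition swap_adjacent p (w : seq int) :=
  if drop p w is a :: b :: t then take p w ++ [:: b, a & t] else w.

Definition swap_apart p (w : seq int) :=
  if drop p w is a :: m :: b :: t then take p w ++ [:: b, m, a & t] else w.

Lemma perm_mem_signed_words n v w :
  perm_eq v w -> (v \in signed_words n) = (w \in signed_words n).
Proof.
move=> h; rewrite !mem_signed_words; apply/idP/idP; apply: perm_trans.
  by rewrite perm_sym perm_map.
by rewrite perm_map.
Qed.

Lemma swap_adjacentE p w1 a b t : size w1 = p ->
  swap_adjacent p (w1 ++ [:: a, b & t]) = w1 ++ [:: b, a & t].
Proof. by move=> <-; rewrite /swap_adjacent drop_size_cat // take_size_cat. Qed.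

Lemma swap_apartE p w1 a m b t : size w1 = p ->
  swap_apart p (w1 ++ [:: a, m, b & t]) = w1 ++ [:: b, m, a & t].
Proof. by move=> <-; rewrite /swap_apart drop_size_cat // take_size_cat. Qed.

Lemma split_adjacent (T : Type) (x0 : T) p (w : seq T) : (p.+1 < size w)%N ->
  exists2 w1, size w1 = p & exists t, w = w1 ++ [:: nth x0 w p, nth x0 w p.+1 & t].
Proof.
move=> h; exists (take p w); first by rewrite size_takel //; lia.
exists (drop p.+2 w); rewrite -{1}(cat_take_drop p w).
by rewrite (drop_nth x0 (n := p)) ?(drop_nth x0 (n := p.+1)) //; lia.
Qed.

Lemma split_apart (T : Type) (x0 : T) p (w : seq T) : (p.+2 < size w)%N ->
  exists2 w1, size w1 = p &
    exists t, w = w1 ++ [:: nth x0 w p, nth x0 w p.+1, nth x0 w p.+2 & t].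
Proof.
move=> h; exists (take p w); first by rewrite size_takel //; lia.
exists (drop p.+3 w); rewrite -{1}(cat_take_drop p w).
rewrite (drop_nth x0 (n := p)) ?(drop_nth x0 (n := p.+1)) //; try lia.
by rewrite (drop_nth x0 (n := p.+2)).
Qed.

(** The sum test is symmetric, while exactly one order of two distinct letters is an inversion,
    which costs -1 for equal colours. *)
Lemma pair_weight_swap_same_color (a b : int) c : a != b ->
  pair_weight (a, c) (b, c) = - pair_weight (b, c) (a, c).
Proof.
rewrite /pair_weight /= addbb [b + a]addrC /pair_factor /=.
by case: (ltgtP a b) => // _ _; case: (a + b < 0); ring.
Qed.

(* Exchanging two neighbouring letters of the same colour negates the weight. *)
Lemma word_sum_eq_adjacent c p : (p.+1 < size c)%N ->
  nth false c p = nth false c p.+1 -> word_sum c = 0.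
Proof.
move=> hp ec.
suff e : word_sum c = - word_sum c.
  by apply: doublep_inj; rewrite mulr0 mulr2n mulrDl mul1r {2}e subrr.
rewrite {1}/word_sum (@signed_words_reindex _ (swap_adjacent p)).
- rewrite /word_sum -sumrN; apply: eq_big_seq => w hw.
  have sw := size_signed_word hw.
  have uw := map_uniq (uniq_absz_signed_word hw).
  have [c1 s1 [c2]] := split_adjacent false hp.
  have hp' : (p.+1 < size w)%N by rewrite sw.
  have [w1 sw1 [w2]] := split_adjacent 0 hp'.
  move: (nth 0 w p) (nth 0 w p.+1) => a b; rewrite -{}ec.
  move: (nth false c p) => d ew -> {hp}; subst w.
  rewrite swap_adjacentE // !zip_cat ?sw1 ?s1 //= !weight_cat.
  rewrite -mulrN; congr (_ * _ * _).
    apply: eq_bigr => x _; rewrite !big_cons; ring.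
  rewrite /= !big_cons.
  rewrite (@pair_weight_swap_same_color b a); first by ring.
  by move: uw; rewrite cat_uniq /= !inE => /and3P [_ _ /andP [/norP []]];
     rewrite eq_sym.
- move=> w hw; have sw := size_signed_word hw.
  have hp' : (p.+1 < size w)%N by rewrite sw.
  have [w1 sw1 [w2]] := split_adjacent 0 hp'.
  move=> ew; rewrite -(perm_mem_signed_words _ (v := w)) //.
  rewrite {}ew swap_adjacentE // perm_cat2l -[[:: _, _ & _]]/([:: _] ++ [:: _] ++ _).
  by rewrite perm_catCA.
move=> w hw; have sw := size_signed_word hw.
have hp' : (p.+1 < size w)%N by rewrite sw.
have [w1 sw1 [w2 ->]] := split_adjacent 0 hp'.
by rewrite !swap_adjacentE.
Qed.

(** * Removing the letter of largest absolute value *)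

Lemma weight_insert u v a :
  weight (u ++ a :: v)
  = (\prod_(b <- u) pair_weight b a) * (\prod_(b <- v) pair_weight a b) * weight (u ++ v).
Proof.
rewrite !weight_cat /=.
have -> : \prod_(x <- u) \prod_(b <- a :: v) pair_weight x b
          = (\prod_(x <- u) pair_weight x a) * (\prod_(x <- u) \prod_(b <- v) pair_weight x b).
  by rewrite -big_split; apply: eq_bigr => x _; rewrite big_cons.
ring.
Qed.

Lemma prod_zip_color (w : seq int) (c : seq bool) (f : int * bool -> {poly int}) g :
  size w = size c -> {in w, forall x, forall e, f (x, e) = g e} ->
  \prod_(a <- zip w c) f a = \prod_(e <- c) g e.
Proof.
elim: w c => [|x w IH] [|e c] //=; first by rewrite !big_nil.
move=> [sz] h.
rewrite !big_cons (h x (mem_head _ _)) IH // => y hy.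
by apply: h; rewrite inE hy orbT.
Qed.

(** The sign of the dominating letter x decides both tests. With a later letter exactly one
    succeeds, for either sign of x; with an earlier letter none succeeds if x > 0 and both do if x <
    0. *)
Lemma weight_insert_max n p (x : int) w c1 d c2 :
  w \in signed_words n -> size c1 = p -> size (c1 ++ c2) = n -> absz x = n.+1 ->
  weight (zip (insert p x w) (c1 ++ d :: c2))
  = (\prod_(e <- c2) pair_factor (d (+) e) true)
    * (if x < 0 then \prod_(e <- c1) pair_factor (d (+) e) true ^+ 2 else 1)
    * weight (zip w (c1 ++ c2)).
Proof.
move=> hw s1 s2 hx; have sw := size_signed_word hw.
have bound y : y \in w -> (absz y <= n)%N.
  by move/(absz_signed_word hw) => /andP [].
have s1' : size (take p w) = size c1.
  by rewrite size_takel // sw -s2 size_cat s1 leq_addr.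
have s2' : size (drop p w) = size c2 by rewrite size_drop sw -s2 size_cat s1 addKn.
rewrite -{2}(cat_take_drop p w) /insert !zip_cat //= weight_insert.
congr (_ * _); rewrite mulrC; congr (_ * _).
  apply: prod_zip_color => // y /mem_drop /bound hy e.
  rewrite /pair_weight /pair_factor /=.
  case: (ltP x 0) => hx0.
    have -> : (y < x) = false by lia.
    by rewrite mul1r ifT //; lia.
  have -> : (x + y < 0) = false by lia.
  by rewrite mulr1 ifT //; lia.
case: (ltP x 0) => hx0.
  apply: prod_zip_color => // y /mem_take /bound hy e.
  rewrite /pair_weight /pair_factor /= addbC.
  have -> : (x < y) by lia.
  have -> : (y + x < 0) by lia.
  by rewrite expr2.
rewrite (prod_zip_color (g := fun=> 1)) ?big1_eq // => y /mem_take /bound hy e.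
rewrite /pair_weight /pair_factor /=.
have -> : (x < y) = false by lia.
have -> : (y + x < 0) = false by lia.
by rewrite mulr1.
Qed.

(** The factor 1 + (square) collects the two signs of the largest letter at position p. *)
Lemma word_sum_rec n c : size c = n.+1 ->
  word_sum c = \sum_(p <- iota 0 n.+1)
    (\prod_(e <- drop p.+1 c) pair_factor (nth false c p (+) e) true)
    * (1 + \prod_(e <- take p c) pair_factor (nth false c p (+) e) true ^+ 2)
    * word_sum (take p c ++ drop p.+1 c).
Proof.
move=> sc; rewrite /word_sum sc signed_wordsS big_allpairs_dep.
rewrite /placements big_allpairs_dep; apply: eq_big_seq => p.
rewrite mem_iota add0n => /andP [_ hp].
have s1 : size (take p c) = p by rewrite size_takel // sc ltnW.
have s2 : size (take p c ++ drop p.+1 c) = n.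
  by rewrite size_cat s1 size_drop sc; lia.
have ec : c = take p c ++ nth false c p :: drop p.+1 c.
  by rewrite -drop_nth ?sc // cat_take_drop.
rewrite s2 big_cons big_seq1.
rewrite /= -big_split /= mulr_sumr; apply: eq_big_seq => w hw.
rewrite [in LHS]ec !(weight_insert_max _ hw s1 s2) ?abszN //=.
by rewrite mulr1; ring.
Qed.

(** * The full sum for alternating colourings *)

Fixpoint alternating b n : seq bool :=
  if n is m.+1 then b :: alternating (~~ b) m else [::].

Lemma size_alternating b n : size (alternating b n) = n.
Proof. by elim: n b => //= n IH b; rewrite IH. Qed.

Lemma nth_alternating b n k :
  (k < n)%N -> nth false (alternating b n) k = b (+) odd k.
Proof.
elim: n b k => //= n IH b [|k] h /=; first by rewrite addbF.
by rewrite IH // addNb addbN.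
Qed.

Lemma alternatingS b n :
  alternating b n.+1 = rcons (alternating b n) (b (+) odd n).
Proof.
elim: n b => [|n IH] b; first by rewrite /= addbF.
by rewrite -[LHS]/(b :: alternating (~~ b) n.+1) IH /= addNb addbN.
Qed.

(** A run of n letters starting with the colour opposite to b has ceil(n/2) letters of that colour;
    these bring the powers of X, and each letter brings a sign. *)
Lemma prod_alternating_fwd b n :
  \prod_(e <- alternating (~~ b) n) pair_factor (b (+) e) true
  = (-1) ^+ n * 'X ^+ (n.+1 %/ 2).
Proof.
(* The starting colour is generalised because the tail of a run starts with the other colour;
   [b (+) b1] corrects the rounding. *)
have h b1 : \prod_(e <- alternating b1 n) pair_factor (b (+) e) true
  = (-1) ^+ n * 'X ^+ ((n + (b (+) b1)) %/ 2).
  elim: n b1 => [|n IH] b1; first by rewrite big_nil; case: (_ (+) _); rewrite mulr1.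
  rewrite /= big_cons IH addbN /pair_factor; case: (b (+) b1) => /=.
    rewrite addn0 exprS (_ : (n.+1 + 1) %/ 2 = (n %/ 2).+1)%N; last by lia.
    by rewrite exprS; ring.
  by rewrite addn0 addn1 exprS; ring.
by rewrite h addbN addbb addn1.
Qed.

(** Here [b (+) odd n] is the colour of the position just after the run; the count is again
    ceil(n/2), and squaring removes the signs. *)
Lemma prod_alternating_bwd b n :
  \prod_(e <- alternating b n) pair_factor (b (+) odd n (+) e) true ^+ 2
  = ('X ^+ (n.+1 %/ 2)) ^+ 2.
Proof.
have h d : \prod_(e <- alternating b n) pair_factor (d (+) e) true ^+ 2
  = ('X ^+ ((n + (d (+) b)) %/ 2)) ^+ 2.
  elim: n b => [|n IH] b; first by rewrite big_nil; case: (_ (+) _); rewrite /= ?expr1n.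
  rewrite /= big_cons IH addbN /pair_factor; case: (d (+) b) => /=.
    rewrite addn0 (_ : (n.+1 + 1) %/ 2 = (n %/ 2).+1)%N; last by lia.
    by rewrite [in RHS](exprS 'X); ring.
  by rewrite addn0 addn1; ring.
rewrite h addbC addbA addbb addFb; congr (('X ^+ _) ^+ 2).
have := odd_double_half n; case: (odd n) => /=; lia.
Qed.

Arguments pair_factor : simpl never.
Arguments alternating : simpl never.

(* Deleting an interior position of an alternating colouring makes two        *)
(* neighbours of equal colour, so the largest letter only contributes at the  *)
(* two ends.                                                                  *)
Lemma word_sum_alternating_step b n :
  word_sum (alternating b n.+2)
  = (-1) ^+ n.+1 * 'X ^+ (n.+2 %/ 2) *+ 2 * word_sum (alternating (~~ b) n.+1)
    + (1 + ('X ^+ (n.+2 %/ 2)) ^+ 2) * word_sum (alternating b n.+1).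
Proof.
set c := alternating b n.+2.
have sc : size c = n.+2 by rewrite size_alternating.
have nc k : (k < n.+2)%N -> nth false c k = b (+) odd k by exact: nth_alternating.
have dc : drop 1 c = alternating (~~ b) n.+1 by [].
have tc : take n.+1 c = alternating b n.+1.
  by rewrite /c alternatingS -cats1 take_size_cat // size_alternating.
clearbody c.
rewrite (word_sum_rec sc) iotaSr /= big_cons big_rcons /=.
rewrite [X in _ + (X + _)]big1_seq => [|p /andP [_]]; last first.
  rewrite mem_iota => hp.
  (* Once position p is deleted, its former neighbours stand at p - 1 and p. *)
  rewrite (@word_sum_eq_adjacent _ p.-1) ?mulr0 //.
    by rewrite size_cat size_takel ?size_drop sc; lia.
  rewrite !nth_cat size_takel ?sc; last by lia.
  rewrite prednK ?ltnn ?subnn; last by lia.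
  rewrite ifT ?nth_take ?nth_drop; try lia.
  by rewrite !nc; lia.
rewrite add0n take0 dc tc nc // addbF prod_alternating_fwd drop_oversize ?sc //.
rewrite nc // prod_alternating_bwd !big_nil cats0 /=; ring.
Qed.

Lemma word_sum_alternating b n :
  word_sum (alternating b n.+1)
  = 2%:R * \prod_(2 <= j < n.+2) (1 + (-1) ^+ (j - 1) * 'X ^+ (j %/ 2)) ^+ 2.
Proof.
elim: n b => [|n IH] b.
  (* A single letter: the words 1 and -1 both have weight 1. *)
  rewrite big_geq // (@word_sum_rec 0) // big_seq1 !big_nil.
  rewrite (_ : word_sum _ = 1) ?mul1r ?mulr1 //.
  by rewrite /word_sum /= /signed_words big_seq1.
rewrite word_sum_alternating_step !IH [in RHS]big_nat_recr //= subn1 /=.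
rewrite [in RHS]sqrrD expr1n mul1r exprMn sqrr_sign mul1r; ring.
Qed.

(** * Sums over words with an ascent *)

Definition ascent p (w : seq int) := nth 0 w p < nth 0 w p.+1.

(* Only the arrangements with the middle letter between the two outer ones    *)
(* survive in the sum over the exchange of the outer letters.                 *)
Lemma weight_swap_apart (y m z : int) d t :
  uniq [:: y; m; z] ->
  let V a b := weight [:: (a, d), (m, ~~ d), (b, d) & t] in
  (1 - 'X ^+ 2) * ((if y < m then V y z else 0) + (if z < m then V z y else 0))
    = V y z + V z y
  /\ (1 - 'X ^+ 2) * ((if m < z then V y z else 0) + (if m < y then V z y else 0))
    = V y z + V z y.
Proof.
rewrite /= !inE negb_or -!andbA => /and4P [nym nyz nmz _].
rewrite !big_cons /pair_weight /= addbb addbN addNb addbb /= [m + y]addrC [z + m]addrC [z + y]addrC.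
move: (\prod_(b <- t) _) (\prod_(b <- t) _) (\prod_(b <- t) _) (weight t).
move=> Ry Rm Rz Rt; rewrite /pair_factor.
(* The factors of negative sums agree in both arrangements, so only the relative order of y, m, z
   matters. *)
move: (if y + m < 0 then _ else _) (if y + z < 0 then _ else _)
  (if m + z < 0 then _ else _) => Sym Syz Smz.
move: nym nyz nmz.
case: (ltgtP y m) => // ? _; case: (ltgtP y z) => // ? _;
  case: (ltgtP m z) => // ? _; try lia; split; ring.
Qed.

Lemma swap_apart_signed_words n p : (p.+2 < n)%N ->
  {in signed_words n, forall w, swap_apart p w \in signed_words n}.
Proof.
move=> hp w hw; have hp' : (p.+2 < size w)%N by rewrite (size_signed_word hw).
have [w1 sw1 [w2 ew]] := split_apart 0 hp'.
rewrite -(perm_mem_signed_words _ (v := w)) //; rewrite {}ew swap_apartE //.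
by rewrite perm_cat2l; apply/seq.permP => a /=; lia.
Qed.

Lemma swap_apartK n p : (p.+2 < n)%N ->
  {in signed_words n, cancel (swap_apart p) (swap_apart p)}.
Proof.
move=> hp w hw; have hp' : (p.+2 < size w)%N by rewrite (size_signed_word hw).
by have [w1 sw1 [w2 ->]] := split_apart 0 hp'; rewrite !swap_apartE.
Qed.

Lemma sum_ascent b n p : (2 < n)%N -> (p.+1 < n)%N ->
  (1 - 'X ^+ 2)
    * \sum_(w <- signed_words n | ascent p w) weight (zip w (alternating b n))
  = word_sum (alternating b n).
Proof.
move=> hn hp; apply: doublep_inj.
(* The exchanged triple must fit into the word: it starts at p if possible, otherwise at p - 1, and
   then the ascent concerns its last two letters. *)
pose q := if (p.+2 < n)%N then p else p.-1.
have hq : (q.+2 < n)%N by rewrite /q; case: ifP; lia.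
pose tau := swap_apart q.
have dbl (f : seq int -> {poly int}) : 2%:R * \sum_(w <- signed_words n) f w
    = \sum_(w <- signed_words n) (f w + f (tau w)).
  rewrite big_split /= -(signed_words_reindex f (swap_apart_signed_words hq) (swap_apartK hq)).
  by rewrite mulr2n mulrDl mul1r.
rewrite big_mkcond mulrCA dbl /word_sum size_alternating dbl mulr_sumr.
apply: eq_big_seq => w hw; have sw := size_signed_word hw.
have hq' : (q.+2 < size w)%N by rewrite sw.
have [w1 sw1 [w2]] := split_apart 0 hq'.
have hc : (q.+2 < size (alternating b n))%N by rewrite size_alternating.
have [c1 sc1 [c2]] := split_apart false hc.
rewrite !nth_alternating; try lia.
rewrite /= addbN negbK; move: (b (+) odd q) => d ec.
move: (nth 0 w q) (nth 0 w q.+1) (nth 0 w q.+2) => y m z ew.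
have uw := map_uniq (uniq_absz_signed_word hw).
have u3 : uniq [:: y; m; z].
  move: uw; rewrite ew cat_uniq -[[:: _, _, _ & _]]/([:: y; m; z] ++ w2).
  by rewrite cat_uniq => /and3P [_ _ /and3P []].
rewrite /tau ew swap_apartE // ec !zip_cat ?sw1 ?sc1 //= !weight_cat.
have -> : \prod_(a <- zip w1 c1) \prod_(e <- [:: (z, d), (m, ~~ d), (y, d) & zip w2 c2]) pair_weight a e
  = \prod_(a <- zip w1 c1) \prod_(e <- [:: (y, d), (m, ~~ d), (z, d) & zip w2 c2]) pair_weight a e.
  by apply: eq_bigr => a _; rewrite !big_cons; ring.
rewrite -mulrDr; set K := weight (zip w1 c1) * _.
have [h1 h2] := weight_swap_apart d (zip w2 c2) u3.
move: h1 h2; set V1 := weight _; set V2 := weight _.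
move=> h1 h2.
have nthq v k : nth 0 (w1 ++ v) (k + q) = nth 0 v k.
  by rewrite nth_cat sw1 ltnNge leq_addl addnK.
rewrite /ascent; case: (ltnP p.+2 n) => hpn.
  have -> : p = q by rewrite /q hpn.
  rewrite !(nthq _ 0%N) !(nthq _ 1%N) /= -h1.
  by case: (y < m); case: (z < m); ring.
have -> : p = q.+1 by rewrite /q ifF; lia.
rewrite !(nthq _ 1%N) !(nthq _ 2%N) /= -h2.
by case: (m < z); case: (m < y); ring.
Qed.

(** * From B_n to D_n by a sign change of the letter 1 *)

Lemma weight_map (g : int -> int) (w : seq int) c :
  {in w &, forall x y, absz x != absz y ->
    (g y < g x) = (y < x) /\ (g x + g y < 0) = (x + y < 0)} ->
  uniq (map absz w) -> weight (zip (map g w) c) = weight (zip w c).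
Proof.
elim: w c => [|x w IH] [|e c] //= hg /andP [xw uw].
rewrite IH //; last first.
  by move=> a b ha hb; apply: hg; rewrite inE ?ha ?hb orbT.
congr (_ * _).
have {IH uw} : {in w, forall y, (g y < g x) = (y < x) /\ (g x + g y < 0) = (x + y < 0)}.
  move=> y hy; apply: hg; rewrite ?mem_head ?inE ?hy ?orbT //.
  by apply: contra xw => /eqP ->; apply: map_f.
elim: w c {hg xw} => [|y w IH] [|e' c] //= h; rewrite ?big_nil // !big_cons IH.
  by rewrite /pair_weight /=; have [-> ->] := h y (mem_head _ _).
by move=> a ha; apply: h; rewrite inE ha orbT.
Qed.

Definition flip1 (x : int) : int := if absz x == 1%N then - x else x.

Lemma absz_flip1 x : absz (flip1 x) = absz x.
Proof. by rewrite /flip1; case: ifP; rewrite ?abszN. Qed.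

Lemma flip1K : involutive flip1.
Proof. by move=> x; rewrite {1}/flip1 absz_flip1 /flip1; case: eqP; rewrite ?opprK. Qed.

(** At most one of x, y has absolute value 1; the other is then larger in absolute value and alone
    fixes the signs of x - y and x + y. *)
Lemma flip1_cmp x y : x != 0 -> y != 0 -> absz x != absz y ->
  (flip1 y < flip1 x) = (y < x) /\ (flip1 x + flip1 y < 0) = (x + y < 0).
Proof.
by rewrite /flip1 => *; case: ifP => ?; case: ifP => ?; split; lia.
Qed.

Lemma signed_word_cmp_flip1 n w : w \in signed_words n -> {in w &, forall x y, absz x != absz y ->
  (flip1 y < flip1 x) = (y < x) /\ (flip1 x + flip1 y < 0) = (x + y < 0)}.
Proof.
move=> hw x y /(absz_signed_word hw) hx /(absz_signed_word hw) hy.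
by apply: flip1_cmp; lia.
Qed.

Lemma map_flip1_signed_word n w :
  w \in signed_words n -> map flip1 w \in signed_words n.
Proof.
move=> hw; rewrite mem_signed_words -map_comp (@eq_map _ _ _ absz) -?mem_signed_words //.
by move=> x /=; exact: absz_flip1.
Qed.

Lemma odd_count_flip1 n w : w \in signed_words n -> (0 < n)%N ->
  odd (count (fun x : int => x < 0) (map flip1 w))
  = ~~ odd (count (fun x : int => x < 0) w).
Proof.
move=> hw n0; have uw := uniq_absz_signed_word hw.
have /mapP [x xw ex] : 1%N \in map absz w.
  by move: hw; rewrite mem_signed_words => /perm_mem ->; rewrite mem_iota; lia.
have x0 := absz_signed_word hw xw.
move: uw; case/splitPr: xw => w1 w2; rewrite map_cat cat_uniq /= -ex.
rewrite negb_or => /and3P [_ /andP [n1 _] /andP [n2 _]].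
have id1 v : 1%N \notin map absz v -> map flip1 v = v.
  move=> nv; apply: map_id_in => y hy; rewrite /flip1 ifF //.
  by apply/negbTE; apply: contra nv => /eqP <-; apply: map_f.
rewrite map_cat /= !id1 // !count_cat /= !oddD /flip1 -ex eqxx.
have -> : (- x < 0) = ~~ (x < 0) by lia.
by case: (x < 0) => /=; do 2 case: odd.
Qed.

(* Changing the sign of the letter of absolute value 1 keeps every comparison *)
(* that enters the weights, and exchanges D_n with its complement in B_n.     *)
Lemma sum_even_negatives n c (P : pred (seq int)) : (0 < n)%N ->
  {in signed_words n, forall w, P (map flip1 w) = P w} ->
  2%:R * \sum_(w <- signed_words n | ~~ odd (count (fun x : int => (x < 0)%R) w) && P w)
    weight (zip w c)
  = \sum_(w <- signed_words n | P w) weight (zip w c).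
Proof.
move=> n0 hP; rewrite [RHS](bigID (fun w => ~~ odd (count (fun x : int => (x < 0)%R) w))) /=.
rewrite mulr2n mulrDl mul1r; congr (_ + _); first by apply: eq_bigl => w; rewrite andbC.
rewrite big_mkcond (@signed_words_reindex _ (map flip1)) /=; last 2 first.
- by move=> w; exact: map_flip1_signed_word.
- by move=> w _; rewrite (mapK flip1K).
rewrite [RHS]big_mkcond; apply: eq_big_seq => w hw.
rewrite hP // (odd_count_flip1 hw n0) andbC negbK.
by rewrite (weight_map _ (signed_word_cmp_flip1 hw)) // (uniq_absz_signed_word hw).
Qed.

(** * The ascent condition of type D *)

Definition neg_head (w : seq int) := if w is x :: t then - x :: t else w.

(** Since y < x means - x + y < 0, and x + y < 0 means y < - x, the two factors of each pair
    containing the first letter trade places. *)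
Lemma weight_neg_head w c : weight (zip (neg_head w) c) = weight (zip w c).
Proof.
case: w c => [|x w] [|e c] //=; congr (_ * _); apply: eq_bigr => -[y d] _.
rewrite /pair_weight /= mulrC; congr (pair_factor _ _ * pair_factor _ _); lia.
Qed.

(** Case 0 is the convention s(0) = - s(2); the value s(j) is the entry of index j - 1. *)
Definition D_ascent i (w : seq int) :=
  if i is p.+1 then ascent p w else - nth 0 w 1 < nth 0 w 0.

Lemma sum_D_ascent0 n c : (1 < n)%N ->
  \sum_(w <- signed_words n | D_ascent 0 w) weight (zip w c)
  = \sum_(w <- signed_words n | ascent 0 w) weight (zip w c).
Proof.
move=> n1; rewrite big_mkcond (@signed_words_reindex _ neg_head) /=.
- rewrite [RHS]big_mkcond; apply: eq_big_seq => w hw.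
  rewrite weight_neg_head /ascent; move: (size_signed_word hw).
  by case: w {hw} => [|x [|y w]] /= e; [lia | lia | rewrite ltrN2].
- by move=> [|x w] //; rewrite !mem_signed_words /= abszN.
by move=> [|x w] //= _; rewrite opprK.
Qed.

Lemma D_ascent_flip1 n i w : (1 < n)%N -> (i < n)%N -> w \in signed_words n ->
  D_ascent i (map flip1 w) = D_ascent i w.
Proof.
move=> n1 hi hw; have sw := size_signed_word hw.
have neq p q : (p < n)%N -> (q < n)%N -> p != q ->
    absz (nth 0 w p) != absz (nth 0 w q).
  move=> hp hq npq; rewrite -!(nth_map _ 0%N) ?sw // nth_uniq ?size_map ?sw //.
  exact: uniq_absz_signed_word hw.
have cmp p q : (p < n)%N -> (q < n)%N -> p != q ->
    (flip1 (nth 0 w q) < flip1 (nth 0 w p)) = (nth 0 w q < nth 0 w p) /\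
    (flip1 (nth 0 w p) + flip1 (nth 0 w q) < 0) = (nth 0 w p + nth 0 w q < 0).
  by move=> hp hq npq; apply: (signed_word_cmp_flip1 hw);
     rewrite ?mem_nth ?sw ?neq.
(* Distinct absolute values exclude x + y = 0. *)
have pos (x y : int) : absz x != absz y -> (- y < x) = ~~ (x + y < 0) by lia.
case: i hi => [|p] hp /=; rewrite /ascent !(nth_map 0) ?sw //; try lia.
  have [_ h] := cmp 0%N 1%N hp n1 isT.
  by rewrite !pos ?h ?absz_flip1 ?neq.
by have [-> _] := cmp p.+1 p hp (ltnW hp) (negbT (gtn_eqF (ltnSn p))).
Qed.

(** * From words back to the group *)

Lemma weight_nth (u : seq (int * bool)) a0 :
  weight u = \prod_(i < size u) \prod_(j < size u | (i < j)%N)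
    pair_weight (nth a0 u i) (nth a0 u j).
Proof.
elim: u => [|a u IH]; first by rewrite big_ord0.
rewrite /= big_ord_recl; congr (_ * _).
  rewrite [RHS]big_mkcond big_ord_recl /= mul1r.
  by rewrite (big_nth a0) big_mkord; apply: eq_bigr.
rewrite IH; apply: eq_bigr => i _.
rewrite [RHS]big_mkcond big_ord_recl /= mul1r [LHS]big_mkcond.
by apply: eq_bigr.
Qed.

Definition word n (s : {perm 'I_(n.*2.+1)}) : seq int :=
  mkseq (fun j => sval_at s j.+1) n.

Lemma nth_word n (s : {perm 'I_(n.*2.+1)}) (i : 'I_n) : nth 0 (word s) i = window s i.
Proof. by rewrite nth_mkseq. Qed.

(** The starting colour b is free: only differences of colours enter, and these record the parity of
    j - i. *)
Lemma weight_word n (s : {perm 'I_(n.*2.+1)}) b :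
  weight (zip (word s) (alternating b n)) = (-1) ^+ ell s * 'X ^+ oddlen s.
Proof.
have sz : size (word s) = size (alternating b n).
  by rewrite size_mkseq size_alternating.
have -> : weight (zip (word s) (alternating b n)) =
  \prod_(i < n) \prod_(j < n | (i < j)%N)
    pair_weight (window s i, b (+) odd i) (window s j, b (+) odd j).
  rewrite (weight_nth _ (0, false)) size_zip -sz minnn size_mkseq.
  apply: eq_bigr => i _; apply: eq_bigr => j _.
  by rewrite !nth_zip // !nth_word !nth_alternating.
have card (P : pred ('I_n * 'I_n)) (x : {poly int}) :
    x ^+ #|[set p | P p]| = \prod_p (if P p then x else 1).
  by rewrite -prodr_const big_mkcond; apply: eq_bigr => p _; rewrite inE.
rewrite pair_big_dep /= /ell /oddlen !exprD !card -!big_split big_mkcond /=.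
apply: eq_bigr => -[i j] _; rewrite /pair_weight /pair_factor /=.
have -> : (i.+1 != j.+1 %[mod 2])%N = (b (+) odd i) (+) (b (+) odd j).
  by case: (b); rewrite !modn2 /=; do 2 case: odd.
case: (i < j)%N => /=; last by rewrite !mul1r.
by case: (window s j < window s i); case: (_ + _ < 0); case: (_ (+) _); rewrite /=; ring.
Qed.

Lemma centered_inj n : injective (@centered n).
Proof. by move=> k l /addIr [] /val_inj. Qed.

Lemma absz_centered n (k : 'I_(n.*2.+1)) : (absz (centered k) <= n)%N.
Proof. by have := ltn_ord k; rewrite /centered; lia. Qed.

Lemma BgroupP n (s : {perm 'I_(n.*2.+1)}) :
  reflect (forall k, s (rev_ord k) = rev_ord (s k)) (s \in Bgroup n).
Proof. by rewrite inE; apply: (iffP forallP) => h k; apply/eqP. Qed.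

Lemma val_inord_add n j : (j <= n)%N -> val (inord (n + j) : 'I_(n.*2.+1)) = (n + j)%N.
Proof. by move=> h; rewrite /= inordK //; lia. Qed.

Lemma absz_eq (x y : int) : absz x = absz y -> x = y \/ x = - y.
Proof. lia. Qed.

(** As s is odd, equality up to sign means s(j) = s(k) or s(j) = s(-k); the latter gives j = -k, so
    j = k = 0. *)
Lemma absz_sval_at_inj n (s : {perm 'I_(n.*2.+1)}) j k : s \in Bgroup n ->
  (j <= n)%N -> (k <= n)%N -> absz (sval_at s j) = absz (sval_at s k) -> j = k.
Proof.
move=> /BgroupP hs hj hk /absz_eq []; rewrite /sval_at -?centeredN -?hs.
  move=> /centered_inj /perm_inj /(congr1 val); rewrite !val_inord_add //; lia.
move=> /centered_inj /perm_inj /(congr1 val).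
rewrite val_inord_add //= -[nat_of_ord (inord _)]/(val (inord _)) val_inord_add //; lia.
Qed.

Lemma sval_at0 n (s : {perm 'I_(n.*2.+1)}) : s \in Bgroup n -> sval_at s 0 = 0.
Proof.
move=> /BgroupP hs; rewrite /sval_at addn0.
have e : rev_ord (inord n : 'I_(n.*2.+1)) = inord n.
  by apply: val_inj; rewrite /= !inordK; lia.
have := centeredN (s (inord n)); rewrite -hs e; lia.
Qed.

Lemma word_signed n (s : {perm 'I_(n.*2.+1)}) :
  s \in Bgroup n -> word s \in signed_words n.
Proof.
move=> hs; rewrite mem_signed_words /word /mkseq -map_comp.
have u : uniq (map (absz \o (fun j => sval_at s j.+1)) (iota 0 n)).
  rewrite map_inj_in_uniq ?iota_uniq // => j k; rewrite !mem_iota !add0n => hj hk.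
  by move=> /(absz_sval_at_inj hs) h; apply/succn_inj/h.
(* Pigeonhole: n distinct absolute values in [1, n] exhaust it; 0 is excluded because s(0) = 0. *)
have [||_ e] := @uniq_min_size _ _ (iota 1 n) u.
- move=> x /mapP [j]; rewrite mem_iota add0n => hj ->; rewrite mem_iota /=.
  rewrite add1n ltnS absz_centered andbT lt0n.
  apply/eqP => e; have := @absz_sval_at_inj n s j.+1 0 hs hj (leq0n _).
  by rewrite (sval_at0 hs) e => /(_ erefl).
- by rewrite size_map !size_iota.
by apply: uniq_perm; rewrite ?iota_uniq.
Qed.

Lemma word_inj n : {in Bgroup n &, injective (@word n)}.
Proof.
move=> s t hs ht e; apply/permP.
have pos j : (j <= n)%N -> s (inord (n + j)) = t (inord (n + j)).
  move=> hj; apply: centered_inj; rewrite -/(sval_at s j) -/(sval_at t j).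
  case: j hj => [|j] hj; first by rewrite !sval_at0.
  by move/(congr1 (nth 0 ^~ j)): e; rewrite !nth_mkseq.
move=> k; have hk := ltn_ord k; case: (leqP n k) => h.
  have -> : k = inord (n + (k - n)) by apply: val_inj; rewrite val_inord_add /=; lia.
  by apply: pos; lia.
have -> : k = rev_ord (inord (n + (n - k))).
  apply: val_inj => /=.
  by rewrite -[nat_of_ord (inord _)]/(val (inord _)) val_inord_add /=; lia.
by rewrite (BgroupP _ hs) (BgroupP _ ht) pos //; lia.
Qed.

Lemma word_surj n w : w \in signed_words n -> exists2 s, s \in Bgroup n & word s = w.
Proof.
move=> hw; have sw := size_signed_word hw.
have bd k : (k < n)%N -> (0 < absz (nth 0%R w k) <= n)%N.
  by move=> hk; apply: (absz_signed_word hw); rewrite mem_nth ?sw.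
(* The odd extension of w to the integers, injective on [-n, n]; shifting by n turns it into the
   permutation sought. *)
pose g (z : int) : int := sgz z * nth 0 w (absz z).-1.
have gN z : g (- z) = - g z by rewrite /g abszN sgzN mulNr.
have g0 : g 0 = 0 by rewrite /g sgz0 mul0r.
have gpos z : 0 < z -> g z = nth 0 w (absz z).-1.
  by move=> hz; rewrite /g gtr0_sgz // mul1r.
have gabsE z : z != 0 -> absz (g z) = absz (nth 0 w (absz z).-1).
  by move=> z0; rewrite /g abszM (_ : absz (sgz z) = 1%N) ?mul1n //; lia.
have gabs (z : int) : (absz z <= n)%N -> (absz (g z) <= n)%N /\ (g z = 0 -> z = 0).
  move=> hz; case: (eqVneq z 0) => [->|z0]; first by rewrite g0.
  have /andP [h1 h2] : (0 < absz (g z) <= n)%N by rewrite gabsE // bd //; lia.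
  by split=> // e; move: h1; rewrite e.
have ginj (z z' : int) : (absz z <= n)%N -> (absz z' <= n)%N -> g z = g z' -> z = z'.
  move=> hz hz' e; have [_ gz] := gabs z hz; have [_ gz'] := gabs z' hz'.
  case: (eqVneq z 0) => [z0|z0]; first by rewrite z0 gz' // -e z0.
  have z'0 : z' != 0 by apply: contra z0 => /eqP z'0; rewrite gz // e z'0.
  have hp : ((absz z).-1 < n)%N by lia.
  have hp' : ((absz z').-1 < n)%N by lia.
  have := congr1 absz e; rewrite !gabsE // => /eqP.
  rewrite -!(nth_map _ 0%N) ?sw // nth_uniq ?size_map ?sw //; last first.
    exact: uniq_absz_signed_word hw.
  move=> /eqP ep; have /absz_eq [//|ez] : absz z = absz z' by lia.
  by have := gN z'; rewrite -ez; lia.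
pose f (k : 'I_(n.*2.+1)) : 'I_(n.*2.+1) := inord (absz (g (centered k) + n%:Z)).
have cf k : centered (f k) = g (centered k).
  have [h _] := gabs _ (absz_centered k).
  by rewrite {1}/centered /f inordK; lia.
have finj : injective f.
  move=> k l /(congr1 (@centered n)); rewrite !cf => /ginj h.
  by apply/centered_inj/h; exact: absz_centered.
exists (perm finj).
  apply/BgroupP => k; apply: centered_inj.
  by rewrite !permE cf !centeredN cf gN.
apply: (@eq_from_nth _ 0); rewrite size_mkseq // => j hj.
by rewrite nth_mkseq // /sval_at permE cf centered_inord // gpos.
Qed.

Lemma sum_Bgroup n (P : pred (seq int)) (F : seq int -> {poly int}) :
  \sum_(s in Bgroup n | P (word s)) F (word s) = \sum_(w <- signed_words n | P w) F w.
Proof.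
rewrite -big_filter_cond -(big_map (@word n) P F).
apply: perm_big; apply: uniq_perm; rewrite ?uniq_signed_words //.
  rewrite map_inj_in_uniq ?enum_uniq ?filter_uniq ?index_enum_uniq //.
  by move=> s t; rewrite !mem_filter => /andP [hs _] /andP [ht _]; apply: word_inj.
move=> w; apply/mapP/idP => [[s]|/word_surj [s hs <-]].
  by rewrite mem_filter => /andP [hs _] ->; apply: word_signed.
by exists s => //; rewrite mem_filter hs mem_index_enum.
Qed.

Lemma mem_Dquotient1 n (i : 'I_n) (s : {perm 'I_(n.*2.+1)}) : (1 < n)%N ->
  (s \in Dquotient [set i])
  = [&& s \in Bgroup n, ~~ odd (count (fun x : int => (x < 0)%R) (word s))
      & D_ascent i (word s)].
Proof.
move=> n1; rewrite !inE -!andbA; congr [&& _, ~~ odd _ & _].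
  rewrite cardE size_filter /word /mkseq -val_enum_ord -map_comp count_map.
  rewrite -enumT; apply: eq_count => k /=; rewrite inE //.
have -> : [forall j in [set i], sval_D s j < sval_D s j.+1]
          = (sval_D s i < sval_D s i.+1).
  apply/forall_inP/idP => [|h j]; first by apply; rewrite inE.
  by rewrite inE => /eqP ->.
case: i => -[|i] hi; rewrite /sval_D /= /ascent !nth_mkseq //; lia.
Qed.

Theorem theorem5p1 (n : nat) (hn : (3 <= n)%N) (i : 'I_n) :
  \sum_(s in Dquotient [set i]) (-1) ^+ ell s * 'X ^+ oddlen s
  = (1 - 'X ^+ 2)
    * \prod_(4 <= j < n.+1) (1 + (-1) ^+ (j - 1) * 'X ^+ (j %/ 2)) ^+ 2
  :> {poly int}.
Proof.
have n1 : (1 < n)%N := ltnW hn.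
have nz : 1 - 'X ^+ 2 != 0 :> {poly int}.
  by rewrite -oppr_eq0 opprB -polyC1 monic_neq0 // monicXnsubC.
(* The factor 2 pays for passing from D_n to B_n, the factor 1 - X^2 for dropping the ascent
   condition. *)
apply: doublep_inj; apply: (mulfI nz).
pose c := alternating false n.
transitivity (word_sum c).
  under eq_bigl do rewrite mem_Dquotient1 //.
  under eq_bigr do rewrite -(weight_word _ false).
  rewrite (@sum_Bgroup n (fun w => ~~ odd (count (fun x : int => (x < 0)%R) w) && D_ascent i w)
    (fun w => weight (zip w c))).
  rewrite sum_even_negatives ?(ltnW n1) //; last first.
    by move=> w; apply: D_ascent_flip1.
  case: i => -[|p] hp /=; last exact: sum_ascent.
  by rewrite sum_D_ascent0 // sum_ascent.
rewrite /c; case: n hn {i n1 c} => // n hn; rewrite word_sum_alternating.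
(* Splits off j = 2 and then j = 3, whose factors multiply to (1 - X^2)^2. *)
rewrite big_ltn; last by lia.
rewrite big_ltn; last by lia.
rewrite /=; ring.
Qed.
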